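(* Let $Q$ be a countable better quasi-order, let $n\in\omega$, and let $\Phi$ be a relation of arity $n+1$ on $Q$. Then $Q$ is thin if and only if both of the following hold: (i) $\{X\in\vec Q:\forall k\in\omega,\ \Phi(X(k),\dots,X(k+n))\}$ is Borel $3$-colourable; (ii) $\{X\in\vec Q:\forall k\in\omega,\ \neg\Phi(X(k),\dots,X(k+n))\}$ is Borel $3$-colourable.
   Context: A quasi-order is a set $Q$ with a reflexive transitive relation $\leqq_Q$. $[\omega]^\omega$ is the set of infinite subsets of $\omega$, identified with strictly increasing sequences and topologized as a subspace of $\omega^\omega$; for infinite $A\subseteq\omega$, $[A]^\omega$ is the set of infinite subsets of $A$. A quasi-order $Q$ is a better quasi-order (BQO) if, giving $Q$ the discrete topology, for every Borel map $f:[\omega]^\omega\to Q$ there is $A\in[\omega]^\omega$ such that $f(B)\leqq_Q f(B\setminus\{\min B\})$ for all $B\in[A]^\omega$. A Borel graph is a pair $(V,E)$ with $V$ Polish and $E\subseteq[V]^2$ Borel. Its Borel chromatic number $\chi_B$ is the least cardinality $|Y|$ of a Polish space $Y$ for which there is a Borel map $V\to Y$ sending adjacent vertices to distinct points. For a countable BQO $Q$, let $\vec Q=\{X\in Q^\omega:\forall k\in\omega,\ X(k)\not\leqq_Q X(k+1)\}$ (subspace of $Q^\omega$ with the product of discrete topologies), regarded as a Borel graph in which distinct $X,Y$ are adjacent iff $S(X)=Y$ or $S(Y)=X$, where $S(X)(k)=X(k+1)$. $Q$ is thin if $\chi_B(\vec Q)\leq 3$. A subset of $\vec Q$ is Borel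 $3$-colourable if the subgraph of $\vec Q$ it induces has Borel chromatic number at most $3$. *)

(* Defs.v *)
From HB Require Import structures.
From mathcomp Require Import all_boot all_order all_algebra.
From mathcomp Require Import all_classical all_reals.
From mathcomp Require Import topology measure.

Set Implicit Arguments.
Unset Strict Implicit.
Unset Printing Implicit Defensive.

Import Order.TTheory.
Local Open Scope card_scope.
Local Open Scope classical_set_scope.
Local Open Scope order_scope.

Definition borel (T : topologicalType) : set (set T) := <<s @open T >>.

Definition borel_map (V Y : topologicalType) (f : V -> Y) : Prop :=
  forall U : set Y, borel U -> borel (f @^-1` U).

Definition separable (T : topologicalType) : Prop :=
  exists2 D : set T, countable D & dense D.

Definition complete_metric (R : realType) (M : metricType R) : Prop :=
  forall F : set_system M, ProperFilter F -> cauchy F -> exists x : M, F --> x.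

Definition homeomorphic (S T : topologicalType) : Prop :=
  exists h : S -> T, exists g : T -> S,
    [/\ cancel h g, cancel g h, continuous h & continuous g].

(* The empty space is Polish with this definition. *)
Definition polish (R : realType) (T : topologicalType) : Prop :=
  separable T /\
  exists2 M : metricType R, complete_metric M & homeomorphic T M.

Definition borel_colourable (V : topologicalType) (E : V -> V -> Prop)
    (Y : topologicalType) : Prop :=
  exists2 c : V -> Y, borel_map c & forall x y, E x y -> c x <> c y.

(* The Borel chromatic number of (V, E) is the cardinality of Y. *)
Definition borel_chromatic (R : realType) (V : topologicalType)
    (E : V -> V -> Prop) (Y : topologicalType) : Prop :=
  [/\ polish R Y, borel_colourable E Y &
      forall Z : topologicalType, polish R Z -> borel_colourable E Z ->
        [set: Y] #<= [set: Z]].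

Definition borel_chromatic_le (R : realType) (V : topologicalType)
    (E : V -> V -> Prop) (n : nat) : Prop :=
  exists2 Y : topologicalType, borel_chromatic R E Y & [set: Y] #<= `I_n.

Definition induced (V : Type) (E : V -> V -> Prop) (A : set V) : A -> A -> Prop :=
  fun x y => E (\val x) (\val y).

Definition shift (T : Type) (u : nat -> T) : nat -> T := fun k => u k.+1.

(* [omega]^omega, an infinite set being identified with its increasing
   enumeration B; the set itself is range (\val B). *)
Definition infsub : set {ptws nat -> nat} :=
  [set u | forall i j : nat, (i < j)%N -> (u i < u j)%N].

Lemma infsub_shift (u : {ptws nat -> nat}) : infsub u -> infsub (shift u).
Proof. by move=> uP i j ij; apply: uP. Qed.

(* The enumeration of B \ {min B}, by range_tail. *)
Definition tail (B : infsub) : infsub :=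
  exist _ (shift (\val B)) (mem_set (infsub_shift (set_mem (valP B)))).

Lemma infsub_min (B : infsub) (m : nat) :
  range (\val B) m -> (\val B 0 <= m)%N.
Proof.
case=> -[|i] _ <- //; apply: ltnW.
exact: (set_mem (valP B)).
Qed.

Lemma range_tail (B : infsub) :
  range (\val (tail B)) = range (\val B) `\ \val B 0%N.
Proof.
have BP : infsub (\val B) := set_mem (valP B).
apply/seteqP; split=> [m [i _ <-]|m [[i _ <-]] /= Bi].
  split; first by exists i.+1.
  by rewrite /= /shift => E; move: (BP 0%N i.+1 isT); rewrite /= [X in (_ < X)%N]E ltnn.
by case: i Bi => [//|i] _; exists i.
Qed.

Definition better_quasi_order (d : Order.disp_t) (Q : preorderType d) : Prop :=
  forall f : infsub -> discrete_topology Q, borel_map f ->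
    exists A : infsub, forall B : infsub, range (\val B) `<=` range (\val A) ->
      (f B : Q) <= (f (tail B) : Q).

Definition qvec (d : Order.disp_t) (Q : preorderType d) :
    set {ptws nat -> discrete_topology Q} :=
  [set X | forall k : nat, ~ ((X k : Q) <= (X k.+1 : Q))].

Arguments qvec {d} Q _.

Definition qvec_adj (d : Order.disp_t) (Q : preorderType d)
    (X Y : qvec Q) : Prop :=
  X <> Y /\ (shift (\val X) = \val Y \/ shift (\val Y) = \val X).

Definition thin (R : realType) (d : Order.disp_t) (Q : preorderType d) : Prop :=
  borel_chromatic_le R (@qvec_adj d Q) 3.

Definition borel_3_colourable (R : realType) (d : Order.disp_t)
    (Q : preorderType d) (A : set (qvec Q)) : Prop :=
  borel_chromatic_le R (induced (@qvec_adj d Q) (A := A)) 3.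

(* Main.v *)
Require Import Defs.
From HB Require Import structures.
From mathcomp Require Import all_boot all_order all_algebra.
From mathcomp Require Import all_classical all_reals.
From mathcomp Require Import topology measure.

Set Implicit Arguments.
Unset Strict Implicit.
Unset Printing Implicit Defensive.

Import Order.TTheory GRing.Theory Num.Theory.

Local Open Scope classical_set_scope.
Local Open Scope card_scope.

(** Thinness passes to subsets by restricting a colouring. Conversely, write
    S for the shift and say that X is marked when Phi holds of its first n + 1
    entries; let A (resp. B) be the set of X all of whose iterated shifts are
    marked (resp. unmarked). Since every edge joins some X to S X, a colouring
    of a set that every orbit meets can be pulled back along the orbits: before
    the first visit, colour X by f (colour of S X), where f has no fixed point
    ([backward_extension]). The given 3-colourings of A and B thus extend to all
    X whose orbit meets A or B. Any other orbit alternates between marked and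
    unmarked infinitely often, so it meets the set C of those X that are
    unmarked with S X marked. No two members of C are adjacent, and C may be
    given the single colour 2: with f exchanging 0 and 1 and sending 2 to 0, the
    colour 2 appears on such orbits only at C, and the points between two visits
    to C take the colours 0 and 1 alternately. This is
    [three_colouring_from_tails], for any Borel map and any Borel set of marked
    points.

    The definition of thinness quantifies over Polish spaces of colours and asks
    for one of least cardinality. By [borel_chromatic_leP] it says no more than
    that there is a proper colouring by m colours with Borel fibres: finite
    discrete spaces are Polish, and in the other direction points are closed in
    a Polish space, so a finite Polish set of colours can be renumbered. *)

(** * Borel sets *)

Lemma borel_open (V : topologicalType) (A : set V) : open A -> borel A.
Proof. exact: sub_sigma_algebra. Qed.

Lemma borel0 (V : topologicalType) : borel (set0 : set V).
Proof. by apply: borel_open; exact: open0. Qed.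

Lemma borelC (V : topologicalType) (A : set V) : borel A -> borel (~` A).
Proof. by rewrite -setTD; exact: sigma_algebraCD. Qed.

Lemma borel_bigcup (V : topologicalType) (F : nat -> set V) :
  (forall k, borel (F k)) -> borel (\bigcup_k F k).
Proof. exact: sigma_algebra_bigcup. Qed.

Lemma borel_bigcap (V : topologicalType) (F : nat -> set V) :
  (forall k, borel (F k)) -> borel (\bigcap_k F k).
Proof.
move=> BF; rewrite -[X in borel X]setCK setC_bigcap.
by apply: borelC; apply: borel_bigcup => k; exact: borelC.
Qed.

Lemma borelU (V : topologicalType) (A B : set V) :
  borel A -> borel B -> borel (A `|` B).
Proof.
move=> BA BB; rewrite -bigcup2E; apply: borel_bigcup => -[|[|k]] //=.
exact: borel0.
Qed.

Lemma borelI (V : topologicalType) (A B : set V) :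
  borel A -> borel B -> borel (A `&` B).
Proof.
move=> BA BB; rewrite -[X in borel X]setCK setCI.
by apply: borelC; apply: borelU; exact: borelC.
Qed.

Lemma continuous_borel_map (V W : topologicalType) (f : V -> W) :
  continuous f -> borel_map f.
Proof.
move=> /continuousP fc U.
apply: (smallest_sub (X := [set W | borel (f @^-1` W)])); last first.
  by move=> O Oo; apply: borel_open; exact: fc.
split=> /= [|A BA|F BF].
- by rewrite preimage_set0; exact: borel0.
- by rewrite setTD preimage_setC; exact: borelC.
- by rewrite preimage_bigcup; exact: borel_bigcup.
Qed.

Lemma iter_borel_map (V : topologicalType) (f : V -> V) (k : nat) :
  borel_map f -> borel_map (iter k f).
Proof. by move=> fB; elim: k => [//|k IH] U BU; exact: IH (fB _ BU). Qed.

Lemma borel_image_val (V : topologicalType) (A : set V) (S : set A) :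
  borel A -> borel S -> borel (set_val @` S).
Proof.
move=> BA; apply: (smallest_sub (X := [set U | borel (set_val @` U)])).
  split=> /= [|S' BS|F BF].
  - by rewrite image_set0; exact: borel0.
  - rewrite setTD.
    have -> : set_val @` (~` S') = A `&` ~` (set_val @` S').
      apply/seteqP; split=> [_ [x Sx <-]|x [Ax Sx]].
        split; first exact: set_valP.
        by move=> [y Sy /val_inj yx]; apply: Sx; rewrite -yx.
      exists (SigSub (mem_set Ax)) => // Sx'; apply: Sx.
      by exists (SigSub (mem_set Ax)).
    by apply: borelI => //; exact: borelC.
  - by rewrite image_bigcup; exact: borel_bigcup.
move=> _ [O oO <-] /=.
have -> : set_val @` (set_val @^-1` O : set A) = A `&` O.
  apply/seteqP; split=> [_ [x Ox <-]|x [Ax Ox]].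
    by split=> //; exact: set_valP.
  by exists (SigSub (mem_set Ax)).
by apply: borelI => //; exact: borel_open.
Qed.

(** * Finite discrete spaces are Polish *)

(** A copy of T carrying the 0-1 metric. The balls of [discrete_topology T] are
    singletons at every radius, whereas the balls of a metric exhaust the
    space. *)
Definition discrete_metric (R : realType) (T : Type) : Type := T.

Section DiscreteMetric.
Variables (R : realType) (T : choiceType).
HB.instance Definition _ := Choice.copy (discrete_metric R T) T.
Let dist (x y : discrete_metric R T) : R := (x != y)%:R.
Let distxx x : dist x x = 0%R. Proof. by rewrite /dist eqxx. Qed.
Let dist_pos x y : dist x y = 0%R -> x = y.
Proof.
by rewrite /dist; case: (eqVneq x y) => //= _ /eqP; rewrite oner_eq0.
Qed.
Let dist_sym x y : dist x y = dist y x.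
Proof. by rewrite /dist eq_sym. Qed.
Let dist_triangle y x z : (dist x z <= dist x y + dist y z)%R.
Proof.
rewrite /dist; case: (eqVneq x y) => [->|_]; first by rewrite add0r.
by rewrite -natrD ler_nat; case: (x != z).
Qed.
HB.instance Definition _ := isMetric.Build R (discrete_metric R T)
  distxx dist_pos dist_sym dist_triangle.

Lemma discrete_metric_ball1 (x : discrete_metric R T) : ball x 1%R = [set x].
Proof.
rewrite ballEmdist; apply/seteqP; split=> [y|_ ->] /=.
  rewrite /mdist /= /dist; case: (eqVneq x y) => [->//|_].
  by rewrite ltxx.
by rewrite /mdist /= distxx.
Qed.

Lemma discrete_metric_complete : complete_metric (discrete_metric R T).
Proof.
move=> F PF Fc.
have /Fc[[U V] /= [FU FV] UV] : entourage
  [set p : discrete_metric R T * discrete_metric R T | ball p.1 1%R p.2].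
  by rewrite -entourage_ballE; exists 1%R => //=; exact: ltr01.
have [x [Ux Vx]] := filter_ex (filterI FU FV).
exists x => O /nbhs_singleton Ox; apply: filterS FV => y Vy.
by have := UV (x, y) (conj Ux Vy); rewrite /= discrete_metric_ball1 => ->.
Qed.

Lemma discrete_metric_polish :
  countable [set: T] -> polish R (discrete_metric R T).
Proof.
move=> Tc; split.
  by exists setT => // O On Oo; rewrite setIT.
exists (discrete_metric R T); first exact: discrete_metric_complete.
by exists id, id; split=> // x; exact: cvg_id.
Qed.
End DiscreteMetric.

(** * Colourings by finitely many colours *)

Lemma polish_closed1 (R : realType) (Z : topologicalType) (z : Z) :
  polish R Z -> closed [set z].
Proof.
move=> [_ [M _ [h [g [hK _ hc _]]]]].
have -> : [set z] = h @^-1` [set h z].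
  apply/seteqP; split=> [_ ->//|y /= hyz].
  by rewrite -[z]hK -hyz hK.
apply: preimage_closed => [y _|]; first exact: hc.
apply: accessible_closed_set1; apply: hausdorff_accessible.
exact: metric_hausdorff.
Qed.

Definition finite_colouring (V : topologicalType) (E : V -> V -> Prop) (m : nat)
    (c : V -> 'I_m) : Prop :=
  (forall i, borel (c @^-1` [set i])) /\ (forall x y, E x y -> c x <> c y).

Lemma colouring_preimage (V : topologicalType) (m : nat) (c : V -> 'I_m)
    (U : set 'I_m) :
  (forall i, borel (c @^-1` [set i])) -> borel (c @^-1` U).
Proof.
move=> cB.
have -> : c @^-1` U = \bigcup_k [set x | c x = k :> nat /\ U (c x)].
  by apply/seteqP; split=> [x Ux|x [k _ [_]]//]; exists (val (c x)).
apply: borel_bigcup => k.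
have [[i [ik Ui]]|noi] := pselect (exists i : 'I_m, i = k :> nat /\ U i).
  suff -> : [set x | c x = k :> nat /\ U (c x)] = c @^-1` [set i] by exact: cB.
  apply/seteqP; split=> [x [cxk _]|x /= ->//].
  by apply: val_inj; rewrite /= cxk ik.
suff -> : [set x | c x = k :> nat /\ U (c x)] = set0 by exact: borel0.
by rewrite -subset0 => x [cxk Ux]; apply: noi; exists (c x).
Qed.

(** Renumbering the points of a finite Polish space keeps the fibres Borel
    because these points are closed. *)
Lemma finite_colouring_polish (R : realType) (V : topologicalType)
    (E : V -> V -> Prop) (Z : topologicalType) (m : nat) :
  polish R Z -> borel_colourable E Z -> [set: Z] #<= `I_m ->
  exists c : V -> 'I_m, finite_colouring E c.
Proof.
move=> Zp [c cB cE] /card_leP[h].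
have hP z : (\val (h (SigSub (mem_set (I : [set: Z] z)))) < m)%N.
  by exact: set_valP (h _).
pose e z := Ordinal (hP z).
have eI : injective e.
  move=> y z [/val_inj eyz].
  have /(_ _ _ _ _ eyz) := @inj _ _ _ h.
  by rewrite !inE => /(_ I I) [].
exists (e \o c); split=> [i|x y /cE cxy /eI//].
have [[z ez]|noz] := pselect (exists z, e z = i).
  have -> : (e \o c) @^-1` [set i] = c @^-1` [set z].
    apply/seteqP; split=> [x /= exi|x /= -> //].
    by apply: eI; rewrite exi.
  apply: cB; rewrite -[X in borel X]setCK; apply: borelC; apply: borel_open.
  by rewrite openC; exact: polish_closed1 Zp.
suff -> : (e \o c) @^-1` [set i] = set0 by exact: borel0.
by rewrite -subset0 => x /= exi; apply: noz; exists (c x).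
Qed.

(** For the converse, the least number of colours of a finite colouring realizes
    the Borel chromatic number: a Polish space with fewer points would, by
    [finite_colouring_polish], give a finite colouring with fewer colours. *)
Lemma borel_chromatic_leP (R : realType) (V : topologicalType)
    (E : V -> V -> Prop) (m : nat) :
  borel_chromatic_le R E m <-> exists c : V -> 'I_m, finite_colouring E c.
Proof.
split=> [[Y [Yp Yc _] Ym]|Vm]; first exact: finite_colouring_polish Yp Yc Ym.
pose P k := `[< exists c : V -> 'I_k, finite_colouring E c >].
have Pm : exists k, P k by exists m; apply/asboolP.
case: (ex_minnP Pm) => k /asboolP[c [cB cE]] kmin.
have km : (k <= m)%N by apply: kmin; apply/asboolP.
have Yk : [set: discrete_metric R 'I_k] #= `I_k.
  by rewrite card_eq_sym; exact: card_II.
exists (discrete_metric R 'I_k); last first.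
  by rewrite (card_le_eql Yk) card_le_II.
split.
- apply: discrete_metric_polish; exact: countableP.
- exists c => // U _; exact: colouring_preimage.
- move=> Z Zp Zc; rewrite (card_le_eql Yk).
  have [/finite_setP[j Zj]|Zinf] := pselect (finite_set [set: Z]); last first.
    exact: card_le_trans (card_leT _) ((infiniteP _).1 Zinf).
  rewrite (card_le_eqr Zj) card_le_II; apply: kmin; apply/asboolP.
  by apply: finite_colouring_polish Zp Zc _; rewrite (card_le_eql Zj).
Qed.

Lemma finite_colouring_induced (V : topologicalType) (E : V -> V -> Prop)
    (m : nat) (A : set V) :
  (exists c : V -> 'I_m, finite_colouring E c) ->
  exists c : A -> 'I_m, finite_colouring (induced E (A := A)) c.
Proof.
move=> [c [cB cE]]; exists (c \o set_val); split=> [i|x y]; last exact: cE.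
apply: (continuous_borel_map _ (cB i)); exact: initial_continuous.
Qed.

(** * Colouring along the orbits of a map *)

(** The colour of x is obtained from that of its first visit to D by applying f
    once per step. Comparing x with T x then reduces to comparing f i with i
    outside D, so only the points of D need a further argument. *)
Lemma backward_extension (V : topologicalType) (T : V -> V) (D : set V)
    (m : nat) (f : 'I_m -> 'I_m) (c0 : V -> 'I_m) :
  borel_map T -> borel D -> (forall x, exists k, D (iter k T x)) ->
  (forall i, borel (c0 @^-1` [set i])) ->
  exists c : V -> 'I_m,
    [/\ forall i, borel (c @^-1` [set i]),
        forall x, D x -> c x = c0 x &
        forall x, ~ D x -> c x = f (c (T x))].
Proof.
move=> TB DB Dhit c0B.
have Phit x : exists k, `[< D (iter k T x) >].
  by have [k Dk] := Dhit x; exists k; apply/asboolP.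
pose hit x := ex_minn (Phit x).
have hitE x k : D (iter k T x) -> (forall j, (j < k)%N -> ~ D (iter j T x)) ->
    hit x = k.
  rewrite /hit; case: ex_minnP => h /asboolP Dh hmin Dk kmin.
  apply/eqP; rewrite eqn_leq hmin ?andTb; last exact/asboolP.
  by rewrite leqNgt; apply/negP => /kmin.
have hitD x : D (iter (hit x) T x).
  by rewrite /hit; case: ex_minnP => h /asboolP.
have hit_min x j : (j < hit x)%N -> ~ D (iter j T x).
  rewrite /hit; case: ex_minnP => h _ hmin jh Dj.
  by move: jh; rewrite ltnNge hmin //; apply/asboolP.
exists (fun x => iter (hit x) f (c0 (iter (hit x) T x))); split.
- move=> i; set C := _ @^-1` _.
  have -> : C = \bigcup_k ((\bigcap_j [set x | (j < k)%N -> ~ D (iter j T x)])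
      `&` (iter k T @^-1` D
           `&` iter k T @^-1` (c0 @^-1` (iter k f @^-1` [set i])))).
    apply/seteqP; split=> [x Cx|x [k _ [kmin [Dk /= ck]]]].
      exists (hit x) => //; split=> [j _ /=|]; first exact: hit_min.
      by split; [exact: hitD|].
    have hk : hit x = k by apply: hitE => // j; exact: kmin.
    by rewrite /C /= hk.
  apply: borel_bigcup => k; apply: borelI; last first.
    apply: borelI; first exact: iter_borel_map.
    by apply: iter_borel_map => //; exact: colouring_preimage.
  apply: borel_bigcap => j; case: (ltnP j k) => jk.
    have -> : [set x | true -> ~ D (iter j T x)] = iter j T @^-1` (~` D).
      by apply/seteqP; split=> x /=; [exact|].
    by apply: iter_borel_map => //; exact: borelC.
  suff -> : [set x | false -> ~ D (iter j T x)] = setT.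
    by apply: borel_open; exact: openT.
  by apply/seteqP; split.
- by move=> x Dx; have -> : hit x = 0%N by apply: hitE.
- move=> x Dx.
  have -> : hit x = (hit (T x)).+1.
    apply: hitE; first by rewrite iterSr; exact: hitD.
    by case=> [_ //|j]; rewrite ltnS iterSr => /hit_min.
  by rewrite (iterSr _ T) iterS.
Qed.

(** A and B are closed under T, so an edge that leaves a point of A or B stays
    in it and is handled by the given colouring. An edge leaving a point x of C
    ends outside A, B and C, hence at a point coloured by a value of f; this is
    why f must avoid the colour of C and why C excludes the points whose orbit
    meets A or B, where any colour could follow. *)
Lemma three_colouring_from_tails (V : topologicalType) (T : V -> V)
    (E : V -> V -> Prop) (U : set V) :
  borel_map T -> (forall x y, E x y -> T x = y \/ T y = x) -> borel U ->
  let A := [set x | forall k, U (iter k T x)] in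
  let B := [set x | forall k, ~ U (iter k T x)] in
  (exists a : A -> 'I_3, finite_colouring (induced E (A := A)) a) ->
  (exists b : B -> 'I_3, finite_colouring (induced E (A := B)) b) ->
  exists c : V -> 'I_3, finite_colouring E c.
Proof.
move=> TB ET UB A B [a [aB aE]] [b [bB bE]].
have TA x : A x -> A (T x) by move=> Ax k; rewrite -iterSr; exact: Ax.
have TTB x : B x -> B (T x) by move=> Bx k; rewrite -iterSr; exact: Bx.
have AB0 x : A x -> B x -> False by move=> Ax Bx; exact: Bx 0%N (Ax 0%N).
have AB : borel A.
  have -> : A = \bigcap_k (iter k T @^-1` U).
    by apply/seteqP; split=> x Ax k; [move=> _; exact: Ax|exact: Ax].
  by apply: borel_bigcap => k; exact: iter_borel_map.
have BB : borel B.
  have -> : B = \bigcap_k (iter k T @^-1` (~` U)).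
    by apply/seteqP; split=> x Bx k; [move=> _; exact: Bx|exact: Bx].
  by apply: borel_bigcap => k; apply: iter_borel_map => //; exact: borelC.
pose evAB := \bigcup_k (iter k T @^-1` (A `|` B)).
have evABB : borel evAB.
  by apply: borel_bigcup => k; apply: iter_borel_map => //; exact: borelU.
pose C := (~` U `&` T @^-1` U) `&` ~` evAB.
have CB : borel C.
  apply: borelI; last exact: borelC.
  by apply: borelI; [exact: borelC|exact: TB].
pose c0 x : 'I_3 := match pselect (A x), pselect (B x) with
  | left Ax, _ => a (SigSub (mem_set Ax))
  | _, left Bx => b (SigSub (mem_set Bx))
  | _, _ => ord_max end.
have c0A (x : A) : c0 (\val x) = a x.
  rewrite /c0; case: pselect => [Ax|/(_ (set_valP x))//].
  by congr a; exact: val_inj.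
have c0B (x : B) : c0 (\val x) = b x.
  rewrite /c0; case: pselect => [/AB0/(_ (set_valP x))//|_].
  case: pselect => [Bx|/(_ (set_valP x))//].
  by congr b; exact: val_inj.
have c0N x : ~ A x -> ~ B x -> c0 x = ord_max.
  by rewrite /c0; case: pselect => // _; case: pselect.
have c0Bo i : borel (c0 @^-1` [set i]).
  have -> : c0 @^-1` [set i] = set_val @` (a @^-1` [set i])
      `|` (set_val @` (b @^-1` [set i])
      `|` (~` (A `|` B) `&` [set x | ord_max = i])).
    apply/seteqP; split=> [x /= c0x|].
      have [Ax|nA] := pselect (A x).
        by left; exists (SigSub (mem_set Ax)) => //=; rewrite -c0A.
      have [Bx|nB] := pselect (B x).
        by right; left; exists (SigSub (mem_set Bx)) => //=; rewrite -c0B.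
      by right; right; split; [case|rewrite /= -c0x c0N].
    move=> x [[y /= ay <-]|[[y /= eb <-]|[/= nAB <-]]].
    - by rewrite -ay -c0A.
    - by rewrite -eb -c0B.
    - by apply: c0N => ?; apply: nAB; [left|right].
  apply: borelU; first exact: borel_image_val.
  apply: borelU; first exact: borel_image_val.
  apply: borelI; first by apply: borelC; exact: borelU.
  have [mi|mi] := eqVneq ord_max i.
    suff -> : [set _ : V | ord_max = i] = setT.
      by apply: borel_open; exact: openT.
    by apply/seteqP; split.
  suff -> : [set _ : V | ord_max = i] = set0 by exact: borel0.
  by rewrite -subset0 => x /= /eqP; rewrite (negPf mi).
pose D := (A `|` B) `|` C.
have DB : borel D by apply: borelU => //; exact: borelU.
have Dhit x : exists k, D (iter k T x).
  have [[k _ ABk]|nev] := pselect (evAB x); first by exists k; left.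
  have evN k : ~ evAB (iter k T x).
    by move=> [j _]; rewrite /= -iterD => ABj; apply: nev; exists (j + k)%N.
  have [k nUk] : exists k, ~ U (iter k T x).
    by apply/existsNP => Ax; apply: nev; exists 0%N => //; left.
  have [j] : exists j, U (iter (j + k) T x).
    apply: contrapT => nU; apply: nev; exists k => //; right => j Uj.
    by apply: nU; exists j; rewrite iterD.
  (* the least such j is positive, and the step before it is a point of C *)
  elim: j => [//|j IH] Uj.
  have [/IH //|nUj] := pselect (U (iter (j + k) T x)).
  by exists (j + k)%N; right; split=> //; exact: evN.
pose f (i : 'I_3) : 'I_3 := if i == ord0 then inord 1 else ord0.
have f_neq i : i <> f i.
  rewrite /f; have [->|i0] := eqVneq i ord0; last exact/eqP.
  by move/(congr1 val); rewrite /= inordK.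
have f_max i : ord_max <> f i.
  by rewrite /f; case: ifP => _ /(congr1 val); rewrite /= ?inordK.
have [c [cBo cD cN]] := backward_extension f TB DB Dhit c0Bo.
exists c; split=> //.
suff cT x : E x (T x) \/ E (T x) x -> c x <> c (T x).
  move=> x y Exy; have [Tx|Ty] := ET x y Exy.
    by rewrite -Tx; apply: cT; left; rewrite Tx.
  by rewrite -Ty => /esym; apply: cT; right; rewrite Ty.
move=> ExT; have [Dx|/cN ->] := pselect (D x); last exact/nesym/f_neq.
have [[Ax|Bx]|[[nUx UTx] nev]] := Dx.
- have ATx := TA x Ax; rewrite !cD //; last by left; left.
  rewrite -[x in c0 x]/(\val (SigSub (mem_set Ax) : A)) c0A.
  rewrite -[T x]/(\val (SigSub (mem_set ATx) : A)) c0A.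
  by case: ExT => Ex; [|apply: nesym]; exact: aE.
- have BTx := TTB x Bx; rewrite !cD //; last by left; right.
  rewrite -[x in c0 x]/(\val (SigSub (mem_set Bx) : B)) c0B.
  rewrite -[T x]/(\val (SigSub (mem_set BTx) : B)) c0B.
  by case: ExT => Ex; [|apply: nesym]; exact: bE.
- have nAB : ~ (A `|` B) x by move=> ABx; apply: nev; exists 0%N.
  rewrite cD // c0N; first last.
  - by move=> ?; apply: nAB; right.
  - by move=> ?; apply: nAB; left.
  rewrite cN; first exact: f_max.
  by move=> [ABTx|[[/(_ UTx)]]//]; apply: nev; exists 1%N.
Qed.

(** * The shift on bad sequences *)

Section ShiftGraph.
Variables (d : Order.disp_t) (Q : preorderType d).

Lemma qvec_shift (X : qvec Q) : qvec Q (shift (\val X)).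
Proof. by move=> k; have := set_valP X; exact. Qed.

Definition qshift (X : qvec Q) : qvec Q := SigSub (mem_set (@qvec_shift X)).

Lemma val_iter_qshift (X : qvec Q) (k : nat) :
  \val (iter k qshift X) = (fun i => \val X (k + i)%N) :> (nat -> Q).
Proof.
elim: k => [//|k IH]; apply/funext => i.
by rewrite iterS addSnnS -[RHS]/((fun j => \val X (k + j)%N) i.+1) -IH.
Qed.

Lemma qvec_coord_continuous (i : nat) :
  continuous (fun X : qvec Q => \val X i : discrete_topology Q).
Proof.
move=> X; apply: (@continuous_comp _ _ _ set_val
  (fun u : {ptws nat -> discrete_topology Q} => u i)).
  exact: initial_continuous.
exact: (@proj_continuous nat (fun=> discrete_topology Q)).
Qed.

Lemma qshift_continuous : continuous qshift.
Proof.
apply/continuousP => _ [O oO <-].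
have sc : continuous (fun X : qvec Q =>
    shift (\val X) : {ptws nat -> discrete_topology Q}).
  move=> X; apply/cvg_sup; first exact/fmap_filter/(nbhs_filter X).
  move=> i W /= [_ [[N oN <-] /= NX] /filterS].
  apply; first exact/fmap_filter/(nbhs_filter X).
  exact: (@qvec_coord_continuous i.+1 X N (open_nbhs_nbhs (conj oN NX))).

by move/continuousP: sc => /(_ _ oO).
Qed.

Lemma window_open (n : nat) (P : ('I_n -> Q) -> Prop) :
  open [set X : qvec Q | P (fun i => \val X i)].
Proof.
rewrite openE => X PX; rewrite /interior /=.
have : nbhs X [set Y : qvec Q | forall i : 'I_n, \val Y i = \val X i].
  apply: (@filter_forall _ _
    (fun (i : 'I_n) (Y : qvec Q) => \val Y i = \val X i) _
    (nbhs_filter X)) => i.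
  exact: (@qvec_coord_continuous i X [set \val X i] (discrete_set1 _)).
apply: filterS => Y YX /=.
rewrite (_ : (fun i : 'I_n => \val Y i) = (fun i : 'I_n => \val X i)) //.
exact/funext.
Qed.
End ShiftGraph.

Theorem lemma3p1 (R : realType) (d : Order.disp_t) (Q : preorderType d)
    (Qcountable : countable [set: Q]) (Qbqo : better_quasi_order Q)
    (n : nat) (Phi : ('I_n.+1 -> Q) -> Prop) :
  thin R Q <->
  borel_3_colourable R
    [set X : qvec Q |
      forall k : nat, Phi (fun i : 'I_n.+1 => \val X (k + i)%N)] /\
  borel_3_colourable R
    [set X : qvec Q |
      forall k : nat, ~ Phi (fun i : 'I_n.+1 => \val X (k + i)%N)].
Proof.
split=> [/borel_chromatic_leP cQ|].
  by split; apply/borel_chromatic_leP; exact: finite_colouring_induced.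
move=> [/borel_chromatic_leP PhiA /borel_chromatic_leP PhiB].
apply/borel_chromatic_leP.
pose U := [set X : qvec Q | Phi (fun i : 'I_n.+1 => \val X i)].
have UE k (X : qvec Q) :
    U (iter k (@qshift d Q) X) = Phi (fun i : 'I_n.+1 => \val X (k + i)%N).
  by rewrite /U /= val_iter_qshift.
apply: (@three_colouring_from_tails _ (@qshift d Q) _ U).
- by apply: continuous_borel_map; exact: qshift_continuous.
- by move=> X Y [_ [XY|YX]]; [left|right]; exact: val_inj.
- by apply: borel_open; exact: (@window_open _ _ _ Phi).
- rewrite (_ : [set X | _] = [set X : qvec Q |
      forall k : nat, Phi (fun i : 'I_n.+1 => \val X (k + i)%N)]) //.
  by apply/seteqP; split=> X XU k; [rewrite -UE|rewrite UE]; exact: XU.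
- rewrite (_ : [set X | _] = [set X : qvec Q |
      forall k : nat, ~ Phi (fun i : 'I_n.+1 => \val X (k + i)%N)]) //.
  by apply/seteqP; split=> X XU k; [rewrite -UE|rewrite UE]; exact: XU.
Qed.
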